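(* Let $(\mathcal{B},\mathcal{L},\theta,\mathcal{I}_\alpha)$ be a generalized Boolean dynamical system, and $S$ be its associated inverse semigroup. Then the ultrafilters in $E(S)$ are exactly: (i) the filters of finite type $\xi^\alpha$ such that $\xi_{|\alpha|}$ is an ultrafilter in $\mathcal{I}_\alpha$ and for each $\beta\in\mathcal{L}$ there exists $A\in\xi_{|\alpha|}$ such that $\theta_\beta(A)=\emptyset$; (ii) the filters of infinite type $\xi^\alpha$ such that $\xi_n$ is an ultrafilter (in $\mathcal{I}_{\alpha_{1,n}}$) for every $n>0$ and $\xi_0$ is either an ultrafilter (in $\mathcal{B}$) or the empty set.
   Context: **Generalized Boolean dynamical systems.** A Boolean algebra $\mathcal{B}$ is a (not necessarily unital) relatively complemented distributive lattice with least element $\emptyset$ and operations $\cap,\cup,\setminus$; $A\subseteq B$ means $A\cap B=A$. An ideal is a non-empty subset closed under finite unions and under intersection with arbitrary elements of $\mathcal{B}$. An action is a map $\mathcal{B}\to\mathcal{B}$ preserving $\cap,\cup,\setminus$ and $\emptyset$. A generalized Boolean dynamical system $(\mathcal{B},\mathcal{L},\theta,\mathcal{I}_\alpha)$ consists of a Boolean algebra $\mathcal{B}$, a set $\mathcal{L}$, actions $\{\theta_\alpha\}_{\alpha\in\mathcal{L}}$ and ideals $\{\mathcal{I}_\alpha\}_{\alpha\in\mathcal{L}}$ with $\{A\in\mathcal{B}:A\subseteq\theta_\alpha(B)\text{ for some }B\in\mathcal{B}\}\subseteq\mathcal{I}_\alpha$ for all $\alpha\in\mathcal{L}$. **Words.**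 $\mathcal{L}^*$: finite words over $\mathcal{L}$ (including the empty word $\emptyset$); $\mathcal{L}^\infty$: infinite words; $|\alpha|$: length; $\alpha_{i,j}=\alpha_i\cdots\alpha_j$ (empty if $j<i$). For $\alpha=\alpha_1\cdots\alpha_n$: $\theta_\alpha=\theta_{\alpha_n}\circ\cdots\circ\theta_{\alpha_1}$, $\theta_\emptyset=\mathrm{Id}$; $\mathcal{I}_\alpha=\{A\in\mathcal{B}:A\subseteq\theta_{\alpha_2\cdots\alpha_n}(B)\text{ for some }B\in\mathcal{I}_{\alpha_1}\}$ for $n\ge1$, $\mathcal{I}_\emptyset=\mathcal{B}$. $\mathcal{W}^*=\{\alpha\in\mathcal{L}^*:\mathcal{I}_\alpha\neq\{\emptyset\}\}$, $\mathcal{W}^\infty=\{\alpha\in\mathcal{L}^\infty:\alpha_{1,n}\in\mathcal{W}^*\ \forall n\geq1\}$, $\mathcal{W}^{\leq\infty}=\mathcal{W}^*\cup\mathcal{W}^\infty$. **Inverse semigroup.** $S=\{(\alpha,A,\beta):\alpha,\beta\in\mathcal{L}^*,\ \emptyset\neq A\in\mathcal{I}_\alpha\cap\mathcal{I}_\beta\}\cup\{0\}$, with $0$ absorbing and $(\alpha,A,\beta)(\gamma,B,\delta)$ equal to $(\alpha,A\cap B,\delta)$ if $\beta=\gamma$; $(\alpha\gamma',\theta_{\gamma'}(A)\cap B,\delta)$ if $\gamma=\beta\gamma'$; $(\alpha,A\cap\theta_{\beta'}(B),\delta\beta')$ if $\beta=\gamma\beta'$ (interpreted as $0$ when the middle entry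 is $\emptyset$); $0$ otherwise. Its semilattice of idempotents is $E(S)=\{(\alpha,A,\alpha):\emptyset\neq A\in\mathcal{I}_\alpha\}\cup\{0\}$, ordered by $e\le f$ iff $ef=e$. **Filters.** A filter in a poset with least element is a non-empty, upward closed, downward directed subset not containing the least element; an ultrafilter is a maximal filter. Each filter $\xi$ in $E(S)$ has an associated word $\alpha\in\mathcal{W}^{\leq\infty}$: the longest first entry of elements of $\xi$ if these have bounded length, otherwise the unique infinite word of which all first entries of elements of $\xi$ are beginnings. Write $\xi=\xi^\alpha$ and $\xi_n=\{A\in\mathcal{I}_{\alpha_{1,n}}:(\alpha_{1,n},A,\alpha_{1,n})\in\xi\}$ for $0\le n\le|\alpha|$, $n<\infty$. $\xi^\alpha$ is of finite type if $|\alpha|<\infty$ and of infinite type otherwise. *)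

(* Defs.v *)
From HB Require Import structures.
From mathcomp Require Import all_boot all_order.
From mathcomp Require Import boolp classical_sets.

Set Implicit Arguments.
Unset Strict Implicit.
Unset Printing Implicit Defensive.

Import Order.TTheory.

Local Open Scope classical_set_scope.
(* Opened last, so that meet, join and difference are the lattice operations. *)
Local Open Scope order_scope.

Section Filters.
Context (P : Type) (D : set P) (le : P -> P -> Prop) (z : P).

(* The poset is the subset [D] of [P] ordered by [le], with least element [z]. *)
Record is_filter (F : set P) : Prop := IsFilter {
  filter_sub : forall x, F x -> D x;
  filter_nonempty : exists x, F x;
  filter_up : forall x y, F x -> D y -> le x y -> F y;
  filter_directed : forall x y, F x -> F y ->
    exists t, [/\ F t, le t x & le t y];
  filter_proper : ~ F z }.

Definition is_ultrafilter (F : set P) : Prop :=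
  is_filter F /\
  forall G : set P, is_filter G -> (forall x, F x -> G x) -> G = F.

End Filters.

Section BooleanAlgebras.
Context (d : Order.disp_t) (B : cbDistrLatticeType d).

Record is_ideal (J : set B) : Prop := IsIdeal {
  ideal_nonempty : exists A, J A;
  ideal_join : forall A A', J A -> J A' -> J (A `|` A');
  ideal_meet : forall A A', J A -> J (A `&` A') }.

Record is_action (f : B -> B) : Prop := IsAction {
  action_meet : forall A A', f (A `&` A') = f A `&` f A';
  action_join : forall A A', f (A `|` A') = f A `|` f A';
  action_diff : forall A A', f (A `\` A') = f A `\` f A';
  action_bot : f \bot = \bot }.

End BooleanAlgebras.

Record gbds d (B : cbDistrLatticeType d) (L : eqType) := GBDS {
  theta : L -> B -> B;
  ideal : L -> set B;
  theta_action : forall a, is_action (theta a);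
  ideal_ideal : forall a, is_ideal (ideal a);
  theta_ideal : forall a A, (exists A', A <= theta a A') -> ideal a A }.

(* [Inf w] is the word whose letters are w 0, w 1, w 2, and so on. *)
Inductive word (L : Type) := Fin of seq L | Inf of nat -> L.

Definition wprefix (L : Type) (w : word L) (n : nat) : seq L :=
  match w with
  | Fin u => take n u
  | Inf f => mkseq f n
  end.

Section InverseSemigroup.
Context (d : Order.disp_t) (B : cbDistrLatticeType d) (L : eqType).
Variable G : gbds B L.

(* foldl applies the leftmost letter first. *)
Definition wtheta (u : seq L) (A : B) : B := foldl (fun C a => theta G a C) A u.

Definition wideal (u : seq L) : set B :=
  match u with
  | [::] => [set: B]
  | a :: v => [set A | exists2 A', ideal G a A' & A <= wtheta v A']
  end.

Definition Wfin : set (seq L) := [set u | wideal u <> [set \bot]].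

Definition Winf : set (nat -> L) :=
  [set w | forall n, (1 <= n)%N -> Wfin (mkseq w n)].

Definition Wle_inf : set (word L) :=
  [set w | match w with Fin u => Wfin u | Inf f => Winf f end].

(* The ambient type of S; [None] is the zero element. *)
Definition elt : Type := option (seq L * B * seq L).

Definition mk_elt (u : seq L) (A : B) (v : seq L) : elt :=
  if A == \bot then None else Some (u, A, v).

Definition S_mul (s t : elt) : elt :=
  match s, t with
  | Some (a, A, b), Some (c, C, e) =>
      if b == c then mk_elt a (A `&` C) e
      else if prefix b c then
        let c' := drop (size b) c in mk_elt (a ++ c') (wtheta c' A `&` C) e
      else if prefix c b then
        let b' := drop (size c) b in mk_elt a (A `&` wtheta b' C) (e ++ b')
      else None
  | _, _ => None
  end.

Definition S_set : set elt :=
  [set s | match s with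
           | Some (a, A, b) => [/\ A <> \bot, wideal a A & wideal b A]
           | None => True
           end].

Definition ES : set elt :=
  [set s | s = None \/
    exists a A, [/\ s = Some (a, A, a), A <> \bot & wideal a A]].

Definition ES_le (e f : elt) : Prop := S_mul e f = e.

(* A relation rather than a function: every filter in E(S) has exactly one
   associated word, and it is of the form [Fin u] precisely when the lengths
   of the first entries are bounded. *)
Definition associated_word (xi : set elt) (w : word L) : Prop :=
  Wle_inf w /\
  match w with
  | Fin u => (exists A, xi (Some (u, A, u))) /\
             (forall v A, xi (Some (v, A, v)) -> (size v <= size u)%N)
  | Inf f => (forall n, exists v A, xi (Some (v, A, v)) /\ (n < size v)%N) /\
             (forall v A, xi (Some (v, A, v)) -> v = mkseq f (size v))
  end.

Definition level (xi : set elt) (w : word L) (n : nat) : set B :=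
  [set A | wideal (wprefix w n) A /\
           xi (Some (wprefix w n, A, wprefix w n))].

End InverseSemigroup.

Definition ultrafilter_ES d (B : cbDistrLatticeType d) (L : eqType)
    (G : gbds B L) (xi : set (elt B L)) : Prop :=
  is_ultrafilter (ES G) (ES_le G) None xi.

Definition filter_ES d (B : cbDistrLatticeType d) (L : eqType)
    (G : gbds B L) (xi : set (elt B L)) : Prop :=
  is_filter (ES G) (ES_le G) None xi.

Definition ultrafilter_in d (B : cbDistrLatticeType d) (J F : set B) : Prop :=
  is_ultrafilter J (fun A A' : B => A <= A') \bot F.

(* Main.v *)
(**
An idempotent (u,A,u) lies below (v,C,v) exactly when u = vw and A is contained
in theta_w(C).  Consequently a filter may be cut down freely: if (u,A,u) and
(uw,C,uw) belong to it, so does (uw, C /\ theta_w(A), uw).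

If a filter xi meets the level u, any filter H in I_u containing that level can
be adjoined to xi.  For A in H, D in the level and (uw,C,uw) in xi, the
intersection of C with theta_w(A) is nonzero: otherwise C /\ theta_w(D) would be
contained in theta_w(D \ A), so D \ A would lie in the level, hence in H, next
to A.  Thus all nonempty levels of an ultrafilter are ultrafilters.  If its word
u is finite and theta_b vanishes on no member of the top level, pushing that
level along b yields a strictly larger filter.

Conversely, an element (v,C,v) of a filter eta containing xi can be cut down to
a word u whose xi-level is an ultrafilter, and so equals the eta-level; hence
(v,C,v) already lies in xi.  For finite type, u is the word of xi, and the sets
killed by the theta_b are what prevents eta from containing longer words.
*)
Require Import Defs.
From mathcomp Require Import all_boot all_order.
From mathcomp Require Import boolp classical_sets.

Set Implicit Arguments.
Unset Strict Implicit.
Unset Printing Implicit Defensive.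

Import Order.Theory.

Local Open Scope classical_set_scope.
Local Open Scope order_scope.

Section BooleanDynamicalSystem.
Context (d : Order.disp_t) (B : cbDistrLatticeType d) (L : eqType).
Variable G : gbds B L.
Implicit Types (u v w : seq L) (A C D : B) (xi eta : set (elt B L)).

Definition idem u A : elt B L := Some (u, A, u).

(** Indexed by a word rather than a length, so that it makes sense before [xi] has an associated
    word. *)
Definition level_at xi u : set B :=
  [set A | wideal G u A /\ xi (idem u A)].

(** * Words acting on the Boolean algebra *)

Lemma wtheta_cat u v A : wtheta G (u ++ v) A = wtheta G v (wtheta G u A).
Proof. exact: foldl_cat. Qed.

Lemma wtheta_meet u A C : wtheta G u (A `&` C) = wtheta G u A `&` wtheta G u C.
Proof.
elim: u A C => [//|a u IH] A C /=.
by rewrite (action_meet (theta_action G a)) IH.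
Qed.

Lemma wtheta_diff u A C : wtheta G u (A `\` C) = wtheta G u A `\` wtheta G u C.
Proof.
elim: u A C => [//|a u IH] A C /=.
by rewrite (action_diff (theta_action G a)) IH.
Qed.

Lemma wtheta_bot u : wtheta G u \bot = \bot.
Proof. by elim: u => [//|a u IH] /=; rewrite (action_bot (theta_action G a)). Qed.

Lemma wtheta_le u A C : A <= C -> wtheta G u A <= wtheta G u C.
Proof. by move=> /meet_idPl leAC; apply/meet_idPl; rewrite -wtheta_meet leAC. Qed.

Lemma le_neq_bot A C : A <= C -> A <> \bot -> C <> \bot.
Proof. by move=> leAC A0 C0; apply: A0; apply/eqP; rewrite -lex0 -C0. Qed.

Lemma wtheta_neq_bot u A C : C <= wtheta G u A -> C <> \bot -> A <> \bot.
Proof. by move=> CA C0 A0; apply: (le_neq_bot CA C0); rewrite A0 wtheta_bot. Qed.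

Lemma wideal_le u A C : A <= C -> wideal G u C -> wideal G u A.
Proof.
by case: u => [//|a u] leAC /= [C' aC' CC']; exists C' => //; apply: le_trans CC'.
Qed.

(** For empty [u] this is where [theta_ideal] enters: it puts [theta G a A] into the ideal of
    [a]. *)
Lemma wideal_push u w A C :
  wideal G u A -> C <= wtheta G w A -> wideal G (u ++ w) C.
Proof.
case: u => [_|a u [A' aA' AA'] CA] /=.
  case: w => [//|a w] /= CA; exists (theta G a A) => //.
  by apply: theta_ideal; exists A.
exists A' => //; rewrite wtheta_cat.
exact: le_trans CA (wtheta_le _ AA').
Qed.

(** Empty [u] is excluded because the ideal of a letter may exceed the sets below the range of its
    action; this is how level 0 can be empty in infinite type. *)
Lemma wideal_pull u w C : u <> [::] -> wideal G (u ++ w) C ->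
  exists2 A, wideal G u A & C <= wtheta G w A.
Proof.
case: u => [//|a u] _ /= [A aA]; rewrite wtheta_cat => CA.
by exists (wtheta G u A) => //; exists A.
Qed.

(** * The order on idempotents *)

(** [A] must be nonzero: a product with zero middle entry collapses to [None], which differs from
    [idem u \bot]. *)
Lemma ES_leP u A v C : A <> \bot ->
  ES_le G (idem u A) (idem v C) <-> exists2 w, u = v ++ w & A <= wtheta G w C.
Proof.
move=> A0; rewrite /ES_le /S_mul /idem /mk_elt.
split.
- case: eqP => [->|uv].
    case: eqP => // _ [leAC]; exists [::]; rewrite ?cats0 //.
    by apply/meet_idPl.
  case: ifP => [_|_]; first by case: eqP => // _ [_ _ vu]; case: uv.
  case: ifP => // /prefixP[w ->]; rewrite drop_size_cat //.
  by case: eqP => // _ [leAC]; exists w => //; apply/meet_idPl.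
- case=> w -> leAC; case: eqP => [E|uv].
    have w0 : w = [::] by apply/nilP; rewrite /nilp -(eqn_add2l (size v)) addn0 -size_cat E.
    move: leAC; rewrite {}w0 cats0 => /meet_idPl ->.
    by case: eqP.
  case: ifP => [/size_prefix|_].
    rewrite size_cat -{2}(addn0 (size v)) leq_add2l leqn0 => /nilP w0.
    by case: uv; rewrite w0 cats0.
  rewrite prefix_prefix drop_size_cat //; move: leAC => /meet_idPl ->.
  by case: eqP.
Qed.

Lemma ES_idem u A : A <> \bot -> wideal G u A -> ES G (idem u A).
Proof. by move=> A0 uA; right; exists u, A. Qed.

Lemma ES_le_trans_idem u A v C e : A <> \bot -> C <> \bot -> ES G e ->
  ES_le G (idem u A) (idem v C) -> ES_le G (idem v C) e ->
  ES_le G (idem u A) e.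
Proof.
move=> A0 C0 [->//|[t [E [-> _ _]]]] /(ES_leP _ _ _ A0)[w -> leAC].
move=> /(ES_leP _ _ _ C0)[w' -> CE].
apply/ES_leP => //; exists (w' ++ w); rewrite ?catA // wtheta_cat.
exact: le_trans leAC (wtheta_le _ CE).
Qed.

(** Compares cuts along extended words; this is what makes the cuts in [adjoin] below directed. *)
Lemma meet_wtheta_le w w' A A' C D :
  A <= A' -> C <= wtheta G w D ->
  C `&` wtheta G (w' ++ w) A <= wtheta G w (D `&` wtheta G w' A').
Proof.
move=> AA' CD; rewrite wtheta_meet wtheta_cat leI2 //.
by do 2!apply: wtheta_le.
Qed.

(** * Filters in [E(S)]: lower bounds, cuts and levels *)

Section FilterES.
Variable xi : set (elt B L).
Hypothesis xiF : filter_ES G xi.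

Lemma filter_idem e : xi e ->
  exists u A, [/\ e = idem u A, A <> \bot & wideal G u A].
Proof.
move=> xe; have [e0|//] := filter_sub xiF xe.
by case: (filter_proper xiF); rewrite -e0.
Qed.

Lemma filter_idem_inv u A : xi (idem u A) -> A <> \bot /\ wideal G u A.
Proof. by move=> /filter_idem[v [C [[-> -> _] C0 vC]]]. Qed.

Lemma filter_lower u A v C : xi (idem u A) -> xi (idem v C) ->
  exists t E w w', [/\ xi (idem t E), t = u ++ w, t = v ++ w',
    E <= wtheta G w A & E <= wtheta G w' C].
Proof.
move=> uA vC; have [e [xe]] := filter_directed xiF uA vC.
have [t [E [te E0 _]]] := filter_idem xe; rewrite {}te in xe *.
move=> /(ES_leP _ _ _ E0)[w tu EA] /(ES_leP _ _ _ E0)[w' tv EC].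
by exists t, E, w, w'.
Qed.

Lemma filter_push_up u w A C :
  xi (idem (u ++ w) A) -> wideal G u C -> A <= wtheta G w C -> xi (idem u C).
Proof.
move=> xA uC leAC; have [A0 _] := filter_idem_inv xA.
apply: (filter_up xiF xA).
  by apply: ES_idem => //; apply: wtheta_neq_bot leAC A0.
by apply/ES_leP => //; exists w.
Qed.

(** The middle entry of a common lower bound is below the images of both [A] and [C], hence below
    the image of the cut; upward closure does the rest. *)
Lemma filter_cut u w A C : xi (idem u A) -> xi (idem (u ++ w) C) ->
  xi (idem (u ++ w) (C `&` wtheta G w A)).
Proof.
move=> uA uwC; have [t [E [w1 [w2 [xE tu tv EA EC]]]]] := filter_lower uA uwC.
have w12 : w1 = w ++ w2.
  by have := congr1 (drop (size u)) tv; rewrite tu -catA !drop_size_cat.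
have [_ wC] := filter_idem_inv uwC.
apply: (@filter_push_up _ w2 E); first by rewrite -tv.
  by apply: wideal_le wC; apply: leIl.
by rewrite wtheta_meet lexI EC -wtheta_cat -w12.
Qed.

Lemma level_at_filter u A : xi (idem u A) ->
  is_filter (wideal G u) (fun C D => C <= D) \bot (level_at xi u).
Proof.
move=> uA; split.
- by move=> C [].
- by exists A; split=> //; case: (filter_idem_inv uA).
- move=> C D [_ uC] uD CD; split=> //.
  by apply: (@filter_push_up _ [::] C); rewrite ?cats0.
- move=> C D [wC uC] [wD uD]; exists (D `&` C); split; rewrite ?leIl ?leIr //.
  split; first by apply: wideal_le wC; apply: leIr.
  by have := @filter_cut u [::] C D; rewrite cats0; apply.
- by move=> [_ /filter_idem_inv[]].
Qed.

(** Both words are prefixes of the word of a common lower bound. *)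
Lemma filter_prefix u A v C : xi (idem u A) -> xi (idem v C) ->
  (size u <= size v)%N -> prefix u v.
Proof.
move=> uA vC uv.
have [t [E [w [w' [_ tu tv _ _]]]]] := filter_lower uA vC.
have := congr1 (take (size u)) tv; rewrite tu take_size_cat // takel_cat //.
by move=> ->; apply: prefix_take.
Qed.

End FilterES.

(** The [u]-level of [eta] is a filter containing that of [xi], so maximality identifies the two. *)
Lemma filter_le_ultra xi eta u A C : filter_ES G eta -> xi `<=` eta ->
  ultrafilter_in (wideal G u) (level_at xi u) ->
  xi (idem u A) -> eta (idem u C) -> xi (idem u C).
Proof.
move=> etaF xe [_ umax] uA uC.
have [_ wC] := filter_idem_inv etaF uC.
suff E : level_at eta u = level_at xi u.
  have : level_at eta u C by split.
  by rewrite E => -[].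
by apply: umax; [exact: level_at_filter uC | move=> D [wD /xe]].
Qed.

(** * Adjoining a filter in an ideal to a filter in [E(S)] *)

(** The upward closure of all cuts by members of [H]. Words extending [u] suffice, being cofinal in
    a filter that meets level [u]. *)
Definition adjoin xi u (H : set B) : set (elt B L) :=
  [set e | ES G e /\ exists w C A,
    [/\ xi (idem (u ++ w) C), H A &
        ES_le G (idem (u ++ w) (C `&` wtheta G w A)) e]].

Section Adjoin.
Variables (xi : set (elt B L)) (u : seq L) (H : set B) (D : B).
Hypothesis xiF : filter_ES G xi.
Hypothesis xiD : xi (idem u D).
Hypothesis HF : is_filter (wideal G u) (fun A C => A <= C) \bot H.
Hypothesis xiH : level_at xi u `<=` H.

Lemma adjoin_neq_bot w C A : xi (idem (u ++ w) C) -> H A ->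
  C `&` wtheta G w A <> \bot.
Proof.
move=> uwC HA CA0.
have xCD := filter_cut xiF xiD uwC.
have [_ wD] := filter_idem_inv xiF xiD.
have wDA : wideal G u (D `\` A) by apply: wideal_le wD; exact: leBx.
have HDA : H (D `\` A).
  apply: xiH; split=> //; apply: (filter_push_up xiF xCD wDA).
  by rewrite wtheta_diff leBRL leIr /= meetAC CA0 meet0x.
have [t [Ht tA tDA]] := filter_directed HF HA HDA.
apply: (filter_proper HF); suff <- : t = \bot by [].
apply/eqP; rewrite -lex0; apply: (@le_trans _ _ (A `&` (D `\` A))).
  by rewrite lexI tA tDA.
by rewrite diffKI.
Qed.

Lemma adjoin_filter : filter_ES G (adjoin xi u H).
Proof.
have [A0 HA0] := filter_nonempty HF.
split.
- by move=> e [].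
- exists (idem u (D `&` A0)).
  have [_ wD] := filter_idem_inv xiF xiD.
  have xiD' : xi (idem (u ++ [::]) D) by rewrite cats0.
  have DA := adjoin_neq_bot xiD' HA0.
  split; first by apply: ES_idem => //; apply: wideal_le wD; apply: leIl.
  exists [::], D, A0; split=> //; apply/ES_leP => //.
  by exists [::]; rewrite ?cats0.
- move=> e e' [Ee [w [C [A [xC HA Ce]]]]] Ee' ee'; split=> //.
  exists w, C, A; split=> //.
  have CA := adjoin_neq_bot xC HA.
  case: Ee Ce ee' => [-> //|[v [E [-> E0 vE]]]].
  exact: ES_le_trans_idem.
- move=> e e' [Ee [w [C [A [xC HA Ce]]]]] [Ee' [w' [C' [A' [xC' HA' Ce']]]]].
  have [A2 [HA2 A2A A2A']] := filter_directed HF HA HA'.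
  have [t [E [s [s' [xE ts ts' EC EC']]]]] := filter_lower xiF xC xC'.
  (* Both factorizations of [t] start with [u]; cancelling it leaves one word that serves both
     cuts. *)
  have ws : w' ++ s' = w ++ s.
    by have := congr1 (drop (size u)) ts'; rewrite ts -!catA !drop_size_cat.
  rewrite ts -catA in xE ts'.
  have EA := adjoin_neq_bot xE HA2.
  have [_ wE] := filter_idem_inv xiF xE.
  have EE : ES G (idem (u ++ w ++ s) (E `&` wtheta G (w ++ s) A2)).
    by apply: ES_idem => //; apply: wideal_le wE; apply: leIl.
  exists (idem (u ++ w ++ s) (E `&` wtheta G (w ++ s) A2)); split.
  + split=> //; exists (w ++ s), E, A2; split=> //.
    by apply/ES_leP => //; exists [::]; rewrite ?cats0.
  + apply: ES_le_trans_idem Ce => //; first exact: adjoin_neq_bot.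
    by apply/ES_leP => //; exists s; rewrite ?catA //; apply: meet_wtheta_le.
  + apply: ES_le_trans_idem Ce' => //; first exact: adjoin_neq_bot.
    apply/ES_leP => //; exists s'; rewrite ?ts' // -ws.
    exact: meet_wtheta_le.
- by move=> [_ [w [C [A [_ _]]]]].
Qed.

Lemma sub_adjoin : xi `<=` adjoin xi u H.
Proof.
move=> e xe; split; first exact: filter_sub xiF _ xe.
have [v [C [ev C0 vC]]] := filter_idem xiF xe; subst e.
have [t [E [w [w' [xE tu tv ED EC]]]]] := filter_lower xiF xiD xe.
(* [D] itself is the member of [H] to cut with: the cut of [E] by it stays below the given
   element. *)
have HD : H D by apply: xiH; split=> //; case: (filter_idem_inv xiF xiD).
rewrite tu in xE tv; exists w, E, D; split=> //.
apply/ES_leP; first exact: adjoin_neq_bot.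
by exists w' => //; apply: le_trans EC; apply: leIl.
Qed.

Lemma adjoin_level A : H A -> adjoin xi u H (idem u A).
Proof.
move=> HA; have A0 : A <> \bot by move=> A0; apply: (filter_proper HF); rewrite -A0.
have xiD' : xi (idem (u ++ [::]) D) by rewrite cats0.
split; first by apply: ES_idem => //; apply: filter_sub HF _ HA.
exists [::], D, A; split=> //; apply/ES_leP; first exact: adjoin_neq_bot.
by exists [::] => //; apply: leIr.
Qed.

End Adjoin.

Lemma level_at_ultra xi u D : ultrafilter_ES G xi -> xi (idem u D) ->
  ultrafilter_in (wideal G u) (level_at xi u).
Proof.
move=> [xiF ximax] xiD; split; first exact: (level_at_filter xiF xiD).
move=> H HF xiH; apply/seteqP; split=> // A HA; split; first exact: filter_sub HF _ HA.
rewrite -(ximax _ (adjoin_filter xiF xiD HF xiH) (sub_adjoin xiF xiD HF xiH)).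
exact: adjoin_level xiD _ _ _ HA.
Qed.

(** * Ultrafilters of finite type *)

Section FiniteType.
Variables (xi : set (elt B L)) (u : seq L) (D : B).
Hypothesis xiD : xi (idem u D).
Hypothesis u_max : forall v A, xi (idem v A) -> (size v <= size u)%N.

(** Maximal length forces a common lower bound with [idem u D] to have word [u], so level [u]
    generates [xi]. *)
Lemma finite_type_lower e : filter_ES G xi -> xi e ->
  exists2 A, xi (idem u A) & ES_le G (idem u A) e.
Proof.
move=> xiF xe; have [v [C [ev C0 vC]]] := filter_idem xiF xe; subst e.
have [t [E [w [w' [xE tu tv _ EC]]]]] := filter_lower xiF xiD xe.
have w0 : w = [::].
  have := u_max xE; rewrite tu size_cat -{2}(addn0 (size u)) leq_add2l leqn0.
  by move=> /nilP.
rewrite w0 cats0 in tu; rewrite tu in xE tv; exists E => //.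
by apply/ES_leP; [case: (filter_idem_inv xiF xE) | exists w'].
Qed.

Lemma finite_type_theta b : ultrafilter_ES G xi ->
  exists A, level_at xi u A /\ theta G b A = \bot.
Proof.
move=> [xiF ximax]; apply: contrapT => noA.
have nz A : xi (idem u A) -> theta G b A <> \bot.
  move=> xA A0; apply: noA; exists A; split=> //; split=> //.
  by case: (filter_idem_inv xiF xA).
have ub A : xi (idem u A) -> ES G (idem (u ++ [:: b]) (theta G b A)).
  move=> xA; apply: ES_idem; first exact: nz.
  by have [_ uA] := filter_idem_inv xiF xA; apply: wideal_push uA _.
have le_ub A : xi (idem u A) -> ES_le G (idem (u ++ [:: b]) (theta G b A)) (idem u A).
  by move=> xA; apply/ES_leP; [exact: nz | exists [:: b]].
(* The filter generated by the images of level [u] under [b], all nonzero by [nz]. *)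
pose eta : set (elt B L) := [set e | ES G e /\ exists2 A, xi (idem u A) &
  ES_le G (idem (u ++ [:: b]) (theta G b A)) e].
have eta_ub A : xi (idem u A) -> eta (idem (u ++ [:: b]) (theta G b A)).
  move=> xA; split; first exact: ub.
  by exists A => //; apply/ES_leP; [exact: nz | exists [::]; rewrite ?cats0].
suff etaF : filter_ES G eta.
  have etaE : eta = xi.
    apply: ximax => // e xe; split; first exact: filter_sub xiF _ xe.
    have [A xA Ae] := finite_type_lower xiF xe; exists A => //.
    apply: ES_le_trans_idem (le_ub _ xA) Ae; first exact: nz.
      by case: (filter_idem_inv xiF xA).
    exact: filter_sub xiF _ xe.
  (* Maximality gave [eta = xi], yet [eta] contains a word one letter longer than [u]. *)
  have := eta_ub _ xiD; rewrite etaE => /u_max.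
  by rewrite size_cat addn1 ltnn.
split.
- by move=> e [].
- by exists (idem (u ++ [:: b]) (theta G b D)); apply: eta_ub.
- move=> e e' [Ee [A xA Ae]] Ee' ee'; split=> //; exists A => //.
  case: Ee Ae ee' => [-> //|[v [E [-> E0 vE]]]].
  by apply: ES_le_trans_idem => //; apply: nz.
- move=> e e' [Ee [A xA Ae]] [Ee' [A' xA' Ae']].
  have xAA : xi (idem u (A' `&` A)).
    by have := @filter_cut xi xiF u [::] A A'; rewrite cats0; apply.
  exists (idem (u ++ [:: b]) (theta G b (A' `&` A))); split; first exact: eta_ub.
    apply: ES_le_trans_idem Ae => //; try exact: nz.
    apply/ES_leP; first exact: nz.
    by exists [::]; rewrite ?cats0 //= (wtheta_le [:: b]) // leIr.
  apply: ES_le_trans_idem Ae' => //; try exact: nz.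
  apply/ES_leP; first exact: nz.
  by exists [::]; rewrite ?cats0 //= (wtheta_le [:: b]) // leIl.
- by move=> [_ [A _]].
Qed.

End FiniteType.

(** * Existence of the associated word *)

Lemma neq_bot_Wfin u A : A <> \bot -> wideal G u A -> Wfin G u.
Proof. by move=> A0 uA E; apply: A0; move: uA; rewrite E. Qed.

Lemma filter_pull xi u w A : filter_ES G xi -> u <> [::] ->
  xi (idem (u ++ w) A) -> exists2 C, wideal G u C & xi (idem u C).
Proof.
move=> xiF u0 xA; have [_ uwA] := filter_idem_inv xiF xA.
have [C uC leAC] := wideal_pull u0 uwA.
by exists C => //; exact: (filter_push_up xiF xA uC leAC).
Qed.

Lemma take_mkseq (f : nat -> L) n m : (n <= m)%N -> take n (mkseq f m) = mkseq f n.
Proof. by move=> nm; rewrite /mkseq -map_take take_iota (minn_idPl nm). Qed.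

(** A member with word longer than [n] is pulled back to its beginning of length [n], nonempty as
    [filter_pull] requires. *)
Lemma infinite_type_level xi (f : nat -> L) n : filter_ES G xi ->
  (forall m, exists v A, xi (idem v A) /\ (m < size v)%N) ->
  (forall v A, xi (idem v A) -> v = mkseq f (size v)) ->
  (0 < n)%N -> exists2 C, wideal G (mkseq f n) C & xi (idem (mkseq f n) C).
Proof.
move=> xiF unb fE n0; have [v [A [xA nv]]] := unb n.
apply: (@filter_pull _ _ (drop n v) A) => //.
  by move=> /(congr1 size); rewrite size_mkseq => n0'; rewrite n0' in n0.
suff -> : mkseq f n = take n v by rewrite cat_take_drop.
by rewrite [in RHS](fE _ _ xA) take_mkseq // ltnW.
Qed.

Lemma associated_word_ex xi : filter_ES G xi ->
  exists w : word L, associated_word G xi w.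
Proof.
move=> xiF.
have [[N bN]|unb] := pselect (exists N, forall v A, xi (idem v A) -> (size v <= N)%N).
  pose P n := `[< exists v A, xi (idem v A) /\ size v = n >].
  have exP : exists n, P n.
    have [e xe] := filter_nonempty xiF.
    have [v [A [ev _ _]]] := filter_idem xiF xe; rewrite ev in xe.
    by exists (size v); apply/asboolP; exists v, A.
  have leP n : P n -> (n <= N)%N.
    by move=> /asboolP[v [A [xA <-]]]; apply: bN xA.
  have [_ /asboolP[u [A [xA <-]]] umax] := ex_maxnP exP leP.
  exists (Fin u); have [A0 uA] := filter_idem_inv xiF xA.
  split; first exact: neq_bot_Wfin A0 uA.
  split; first by exists A.
  by move=> v C xC; apply: umax; apply/asboolP; exists v, C.
have {}unb n : exists v A, xi (idem v A) /\ (n < size v)%N.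
  apply: contrapT => h; apply: unb; exists n => v A xA.
  by rewrite leqNgt; apply/negP => nv; apply: h; exists v, A.
(* Letter [n] is read off any sufficiently long word; [onth] avoids a default, since [L] has no
   distinguished letter. *)
have /choice[f fP] n : exists a, exists v A, xi (idem v A) /\ onth v n = Some a.
  have [v [A [xA nv]]] := unb n.
  case E : (onth v n) => [a|]; first by exists a, v, A.
  by move: nv; rewrite ltnNge -onthNE E.
(* Words in the filter are prefix-comparable, so the letters chosen agree with all of them. *)
have fE v A : xi (idem v A) -> v = mkseq f (size v).
  move=> xA; apply: (@eq_from_nth _ (f 0%N)); rewrite ?size_mkseq // => i iv.
  rewrite nth_mkseq //; have [v' [A' [xA' v'i]]] := fP i.
  have iv' : (i < size v')%N by rewrite ltnNge -onthNE v'i.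
  have v'E : nth (f 0%N) v' i = f i by exact: onth_nth.
  have /orP[le|le] := leq_total (size v) (size v').
    have /prefixP[s sE] := filter_prefix xiF xA xA' le.
    by rewrite -v'E sE nth_cat iv.
  have /prefixP[s sE] := filter_prefix xiF xA' xA le.
  by rewrite -v'E sE nth_cat iv'.
exists (Inf f); split; last by split.
move=> n n0; have [C uC xC] := infinite_type_level xiF unb fE n0.
by have [C0 _] := filter_idem_inv xiF xC; apply: neq_bot_Wfin C0 uC.
Qed.

(** * Sufficiency of the two criteria *)

Lemma finite_type_ultra xi u : filter_ES G xi ->
  ultrafilter_in (wideal G u) (level_at xi u) ->
  (forall b, exists A, level_at xi u A /\ theta G b A = \bot) ->
  ultrafilter_ES G xi.
Proof.
move=> xiF uU ub; split=> // eta etaF xe; apply/seteqP; split=> // e ee.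
have [D [_ xD]] := filter_nonempty uU.1.
have [v [C [ev C0 vC]]] := filter_idem etaF ee; subst e.
have [t [E [w [w' [eE tu tv _ EC]]]]] := filter_lower etaF (xe _ xD) ee.
(* Either the lower bound has word [u], where [xi] and [eta] agree, or its word continues with a
   letter [b], which is impossible. *)
subst t; case: w eE tv => [|b w] eE tv.
  rewrite cats0 in eE tv; have xE := filter_le_ultra etaF xe uU xD eE.
  by apply: (@filter_push_up _ xiF _ w' E); rewrite -?tv.
have [A [[_ /xe eA] A0]] := ub b.
(* The cut is below the image of [theta G b A], which is zero. *)
have eEA := filter_cut etaF eA eE.
by case: (filter_idem_inv etaF eEA) => + _; rewrite /= A0 wtheta_bot meetx0.
Qed.

Lemma infinite_type_ultra xi (f : nat -> L) : filter_ES G xi ->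
  (forall m, exists v A, xi (idem v A) /\ (m < size v)%N) ->
  (forall v A, xi (idem v A) -> v = mkseq f (size v)) ->
  (forall n, (0 < n)%N ->
     ultrafilter_in (wideal G (mkseq f n)) (level_at xi (mkseq f n))) ->
  ultrafilter_ES G xi.
Proof.
move=> xiF unb fE fU; split=> // eta etaF xe; apply/seteqP; split=> // e ee.
have [v [C [ev C0 vC]]] := filter_idem etaF ee; subst e.
have [t [A [xA vt]]] := unb (size v).
(* [t] is strictly longer than [v], hence nonempty even if [v] is empty, so its level is covered by
   [fU]. *)
have tU := fU (size t) (leq_ltn_trans (leq0n _) vt); rewrite -(fE _ _ xA) in tU.
have /prefixP[w tE] := filter_prefix etaF ee (xe _ xA) (ltnW vt); subst t.
have xAC := filter_le_ultra etaF xe tU xA (filter_cut etaF ee (xe _ xA)).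
by apply: (filter_push_up xiF xAC vC); apply: leIr.
Qed.

End BooleanDynamicalSystem.

(** * Classification of ultrafilters by type *)

Theorem theorem3p19 (d : Order.disp_t) (B : cbDistrLatticeType d) (L : eqType)
    (G : gbds B L) (xi : set (elt B L)) :
  ultrafilter_ES G xi <->
    (exists alpha : seq L,
      [/\ filter_ES G xi,
          associated_word G xi (Fin alpha),
          ultrafilter_in (wideal G alpha) (level G xi (Fin alpha) (size alpha)) &
          forall beta : L,
            exists A : B, level G xi (Fin alpha) (size alpha) A /\
                          theta G beta A = (\bot)%O])
    \/
    (exists alpha : nat -> L,
      [/\ filter_ES G xi,
          associated_word G xi (Inf alpha),
          forall n : nat, (0 < n)%N ->
            ultrafilter_in (wideal G (mkseq alpha n)) (level G xi (Inf alpha) n) &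
          ultrafilter_in setT (level G xi (Inf alpha) 0) \/
          level G xi (Inf alpha) 0 = set0]).
Proof.
have levelFin u : level G xi (Fin u) (size u) = level_at G xi u.
  by rewrite /level /wprefix take_size.
split=> [xiU|].
  have [xiF _] := xiU; have [[u|f] wE] := associated_word_ex xiF.
    have [_ [[A xA] umax]] := wE.
    left; exists u; rewrite levelFin; split=> //.
      exact: level_at_ultra xiU xA.
    by move=> b; apply: finite_type_theta xA umax b xiU.
  have [_ [unb fE]] := wE.
  right; exists f; split=> //.
    move=> n n0; have [C _ xC] := infinite_type_level xiF unb fE n0.
    exact: level_at_ultra xiU xC.
  (* A nonempty level 0 is an ultrafilter like any other level; the ideal of the empty word is all
     of [B]. *)
  have [[A [_ xA]]|no] := pselect (exists A, level G xi (Inf f) 0 A).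
    by left; apply: level_at_ultra xiU xA.
  by right; apply/seteqP; split=> // A lA; case: no; exists A.
case=> [[u [xiF _ uU ub]]|[f [xiF [_ [unb fE]] fU _]]].
  by rewrite levelFin in uU ub; apply: finite_type_ultra xiF uU ub.
exact: infinite_type_ultra xiF unb fE fU.
Qed.
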